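(* Let $G=(V,E)$ be a graph satisfying $|E|=\frac14|V|(|V|-2)$, and let $H_G$ be the associated bipartite graph defined in the context. The following assertions are equivalent: (i) $G$ has a clique of size $|V|/2$, i.e., $\omega(G)\ge |V|/2$; (ii) $\alpha(H_G)=\alpha_{\mathrm{bal}}(H_G)$. Therefore HALF-SIZE-CLIQUE-EDGE $\le_P$ $\alpha$-BAL-BIP.
   Context: Graphs are finite and simple. $\omega(G)$ is the maximum size of a clique and $\alpha(G)$ the maximum size of an independent set. For a bipartite graph $H$ with bipartition $V_1\cup V_2$, $\alpha_{\mathrm{bal}}(H)$ is the maximum of $|A|+|B|$ over pairs $A\subseteq V_1$, $B\subseteq V_2$ with $|A|=|B|$ and $A\cup B$ independent in $H$. Construction of $H_G$: given $G=(V,E)$ with $n:=|V|$ and $m:=|E|$, $H_G=(V_1\cup V_2,E_H)$ is the bipartite graph constructed as follows. (1) For each $v\in V$ create a vertex $v_1\in V_1$ and a vertex $v_2\in V_2$, and add the edge $\{v_1,v_2\}$. (2) For each $e\in E$ create vertex sets $L_e\subseteq V_1$ and $R_e\subseteq V_2$ with $|L_e|=|R_e|=n+1$, and add all edges between $L_e$ and $R_e$. (3) If $v\in V$ is incident to $e\in E$, make $v_1$ adjacent to all vertices of $R_e$. All the created vertices are distinct, $V_1=\{v_1:v\in V\}\cup\bigcup_{e\in E}L_e$, $V_2=\{v_2:v\in V\}\cup\bigcup_{e\in E}R_e$, and there are no other edges. Problems: HALF-SIZE-CLIQUE-EDGE: given a graph $G=(V,E)$ with $|V|$ even and $|E|=\frac14|V|(|V|-2)$,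 decide whether $\omega(G)\ge|V|/2$. $\alpha$-BAL-BIP: given a bipartite graph $G$ (with its bipartition), decide whether $\alpha(G)=\alpha_{\mathrm{bal}}(G)$. $L_1\le_P L_2$ means that there is a polynomial-time algorithm encoding any instance of $L_1$ as an instance of $L_2$ with the same answer. *)

(* Defs.v *)
From HB Require Import structures.
From mathcomp Require Import all_boot all_order all_algebra.

Set Implicit Arguments.
Unset Strict Implicit.
Unset Printing Implicit Defensive.

Import Order.TTheory GRing.Theory Num.Theory.

(** * Graphs *)

(* A finite simple graph on V is a set of 2-element subsets of V. *)
Record sgraph (V : finType) := SGraph {
  edges : {set {set V}};
  edges_card2 : [forall e in edges, #|e| == 2] }.

Section Graphs.
Variables (V : finType) (G : sgraph V).

Definition adjacent (u v : V) : bool := [set u; v] \in edges G.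

Definition clique (C : {set V}) : bool :=
  [forall u in C, forall v in C, (u != v) ==> adjacent u v].

Definition independent (A : {set V}) : bool :=
  [forall u in A, forall v in A, ~~ adjacent u v].

Definition omega : nat := \max_(C : {set V} | clique C) #|C|.

Definition alpha : nat := \max_(A : {set V} | independent A) #|A|.

(* |E| = |V| (|V| - 2) / 4, over rat: for |V| = 1 the right-hand side is
   negative, which truncated subtraction would hide. *)
Definition quarter_edges : bool :=
  (#|edges G|%:R == 4^-1 * #|V|%:R * (#|V|%:R - 2) :> rat)%R.

End Graphs.

(* A bipartite graph given with its bipartition (V1, V2): the pair (x, y)
   stands for the edge {x, y}. *)
Definition bigraph (V1 V2 : finType) := {set V1 * V2}.

Section Bigraphs.
Variables (V1 V2 : finType) (B : bigraph V1 V2).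

Definition bigraph_edges : {set {set V1 + V2}} :=
  [set [set inl p.1; inr p.2] | p in B].

Lemma bigraph_edges_card2 : [forall e in bigraph_edges, #|e| == 2].
Proof. by apply/forall_inP=> e /imsetP[p _ ->]; rewrite cards2. Qed.

Definition sgraph_of_bigraph : sgraph (V1 + V2)%type :=
  SGraph bigraph_edges_card2.

Definition balanced_independent (P : {set V1} * {set V2}) : bool :=
  (#|P.1| == #|P.2|) &&
  independent sgraph_of_bigraph ((inl @: P.1) :|: (inr @: P.2)).

Definition alpha_bal : nat :=
  \max_(P : {set V1} * {set V2} | balanced_independent P) (#|P.1| + #|P.2|).

End Bigraphs.

Section HG.
Variables (V : finType) (G : sgraph V).

Definition edge_type := {e : {set V} | e \in edges G}.

(* Both V_1 and V_2 are copies of this type: inl v is v_1 (resp. v_2), and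
   inr (e, i), for i < |V| + 1, is the i-th vertex of L_e (resp. R_e). *)
Definition HG_side := (V + edge_type * 'I_(#|V|.+1))%type.

Definition HG_adj (x y : HG_side) : bool :=
  match x, y with
  | inl v, inl w => v == w
  | inr (e, _), inr (f, _) => e == f
  | inl v, inr (e, _) => v \in val e
  | inr _, inl _ => false
  end.

Definition HG : bigraph HG_side HG_side := [set p | HG_adj p.1 p.2].

End HG.

(** * Polynomial-time computable functions on words *)

(* Deterministic multi-tape Turing machines. Every tape is infinite to the
   right and carries the symbol Start in its leftmost cell; a left move from
   that cell has no effect. *)

Inductive symbol := Start | Blank | Bit of bool.

Inductive move := Left | Stay | Right.

Record machine := Machine {
  state : finType;
  tape : finType;
  init_state : state;
  halting : pred state;
  input_tape : tape;
  output_tape : tape;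
  delta : state -> {ffun tape -> symbol} ->
          state * {ffun tape -> symbol * move} }.

Record config (M : machine) := Config {
  cur_state : state M;
  cells : tape M -> nat -> symbol;
  head_pos : tape M -> nat }.

Definition shift (d : move) (i : nat) : nat :=
  match d with Left => i.-1 | Stay => i | Right => i.+1 end.

Definition step (M : machine) (c : config M) : config M :=
  if halting (cur_state c) then c else
  let: (q, a) :=
    delta (cur_state c) [ffun t => cells c t (head_pos c t)] in
  Config q
    (fun t i => if i == head_pos c t then (a t).1 else cells c t i)
    (fun t => shift (a t).2 (head_pos c t)).

(* Start, then the bits of w, then blanks *)
Definition word_cells (w : seq bool) (i : nat) : symbol :=
  if i is j.+1 then nth Blank (map Bit w) j else Start.

Definition init_config (M : machine) (w : seq bool) : config M :=
  Config (init_state M)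
    (fun t => word_cells (if t == input_tape M then w else [::]))
    (fun=> 0).

Definition outputs_within (M : machine) (w : seq bool) (T : nat)
    (w' : seq bool) : Prop :=
  let c := iter T (@step M) (init_config M w) in
  halting (cur_state c) /\ cells c (output_tape M) =1 word_cells w'.

Definition polytime (f : seq bool -> seq bool) : Prop :=
  exists (M : machine) (p : {poly nat}),
    forall w, outputs_within M w p.[size w]%R (f w).

(** * Decision problems and polynomial-time reductions *)

Record decision_problem := DecisionProblem {
  instance : Type;
  code : instance -> seq bool;
  code_inj : injective code;
  yes : instance -> Prop }.

Definition reduces_to (L1 L2 : decision_problem) : Prop :=
  exists2 f : seq bool -> seq bool, polytime f &
    forall x : instance L1, exists2 y : instance L2,
      f (code x) = code y & (yes x <-> yes y).

(* A graph on {0, ..., n-1} is coded by 1^n 0 and its adjacency matrix, and a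
   bipartite graph on parts {0, ..., p-1} and {0, ..., q-1} by 1^p 0 1^q 0 and
   its p x q biadjacency matrix, both in row-major order. *)

Definition matrix_code (p q : nat) (r : 'I_p -> 'I_q -> bool) : seq bool :=
  [seq r u v | u <- enum 'I_p, v <- enum 'I_q].

Definition sgraph_code (n : nat) (G : sgraph 'I_n) : seq bool :=
  nseq n true ++ false :: matrix_code (adjacent G).

Definition bigraph_code (p q : nat) (B : bigraph 'I_p 'I_q) : seq bool :=
  nseq p true ++ false :: nseq q true ++ false ::
    matrix_code (fun u v => (u, v) \in B).

Lemma unary_inj (m n : nat) (s t : seq bool) :
  nseq m true ++ false :: s = nseq n true ++ false :: t -> m = n /\ s = t.
Proof.
elim: m n => [|m IHm] [|n] //= [] => [-> //|/IHm[-> ->] //].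
Qed.

Lemma matrix_code_inj (p q : nat) (r r' : 'I_p -> 'I_q -> bool) :
  matrix_code r = matrix_code r' -> forall u v, r u v = r' u v.
Proof.
have E (s : 'I_p -> 'I_q -> bool) : matrix_code s =
    [seq s x.1 x.2 | x <- [seq (u, v) | u <- enum 'I_p, v <- enum 'I_q]].
  by rewrite map_allpairs.
rewrite !E => /eq_in_map eq_rr' u v; apply: (eq_rr' (u, v)).
by apply/allpairsP; exists (u, v); rewrite !mem_enum.
Qed.

Lemma sgraph_eq (V : finType) (G G' : sgraph V) :
  adjacent G =2 adjacent G' -> G = G'.
Proof.
case: G G' => [E hE] [E' hE']; rewrite /adjacent /= => eqE.
have eqEE' : E = E'.
  apply/setP=> e; have [/cards2P[u [v [_ ->]]]|ne2] := boolP (#|e| == 2).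
    exact: eqE.
  by apply/idP/idP=> [/(forall_inP hE)|/(forall_inP hE')] e2; rewrite e2 in ne2.
by case: _ / eqEE' hE' {eqE} => hE'; rewrite (bool_irrelevance hE hE').
Qed.

Record hsce_instance := HsceInstance {
  hsce_order : nat;
  hsce_graph : sgraph 'I_hsce_order;
  hsce_even : ~~ odd hsce_order;
  hsce_edges : quarter_edges hsce_graph }.

Definition hsce_code (x : hsce_instance) := sgraph_code (hsce_graph x).

Lemma hsce_code_inj : injective hsce_code.
Proof.
move=> [n G o q] [n' G' o' q']; rewrite /hsce_code /= => /unary_inj[eqn].
case: _ / eqn G' o' q' => G' o' q' /matrix_code_inj/sgraph_eq eqG.
case: _ / eqG q' => q'.
by rewrite (bool_irrelevance o o') (bool_irrelevance q q').
Qed.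

Definition half_size_clique_edge : decision_problem :=
  DecisionProblem hsce_code_inj (fun x =>
    (hsce_order x)%:R / 2 <= (omega (hsce_graph x))%:R :> rat)%R.

Record abb_instance := AbbInstance {
  abb_order1 : nat;
  abb_order2 : nat;
  abb_bigraph : bigraph 'I_abb_order1 'I_abb_order2 }.

Definition abb_code (x : abb_instance) := bigraph_code (abb_bigraph x).

Lemma abb_code_inj : injective abb_code.
Proof.
move=> [p q B] [p' q' B']; rewrite /abb_code /= => /unary_inj[eqp].
case: _ / eqp B' => B' /unary_inj[eqq]; case: _ / eqq B' => B'.
move=> /matrix_code_inj eqB; congr AbbInstance.
by apply/setP=> -[u v]; apply: eqB.
Qed.

Definition alpha_bal_bip : decision_problem :=
  DecisionProblem abb_code_inj (fun x =>
    alpha (sgraph_of_bigraph (abb_bigraph x)) = alpha_bal (abb_bigraph x)).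

(* Main.v *)
Require Import Defs.
From mathcomp Require Import all_boot all_order all_algebra.
From mathcomp Require Import zify ring.

(** The pairs v_1 v_2, together with the pairs formed by the i-th vertices of
    L_e and R_e, are a perfect matching of H_G.  When both sides of H_G are
    identified with one set X along this matching, adjacency becomes a
    reflexive relation on X.  An independent set is then a pair (A, C) of
    disjoint subsets of X, so that alpha(H_G) = |X|, and alpha(H_G) is attained
    by a balanced pair exactly when X has a subset A with 2|A| = |X| which is
    closed under adjacency ([alpha_bal_HGP]); C is the complement of A.

    A closed set consists of the copies of a vertex set S and of the blocks of
    an edge set D that contains every edge meeting S ([HG_closedP]).  Since
    blocks have n + 1 elements and |S| is at most n, the equation
    2(|S| + |D|(n + 1)) = n + m(n + 1) splits into 2|S| = n and 2|D| = m.  The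
    m/2 edges outside D lie inside the complement of S, which has n/2 vertices,
    and m = n(n - 2)/4 says that m/2 is the number of all pairs of vertices
    there: that complement is a clique.  The same count read backwards turns a
    clique of size n/2 into a balanced independent set
    ([half_clique_balanced]).

    The reduction writes down H_G itself.  Its Turing machine is assembled from
    fragments by sequence, test and loop; each construct has a Hoare rule that
    also counts steps.  After a setup phase every work tape holds the word 1^n
    for good, and a head position on such a tape is the value of a counter.
    Thus the data of the computation are the head positions and the word
    written so far, and every program piece is specified by the word that it
    appends while it puts all the heads back ([emits]).  Two counters are
    compared by walking both heads to the left in lockstep, and an entry of the
    adjacency matrix is found by walking the head of the input tape to its cell.
    On words that code no graph the machine still runs: n is the number of
    leading ones, and missing matrix entries count as 0.  One polynomial in n,
    read off from the program, therefore bounds the running time on all words.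

    The machine visits the vertices of H_G in an order of its own, so its output
    codes H_G relabelled along an enumeration of its vertices.  Relabelling
    changes neither alpha nor alpha_bal, and the equivalence proved for H_G
    makes the reduction correct. *)

Set Implicit Arguments.
Unset Strict Implicit.
Unset Printing Implicit Defensive.

Import Order.TTheory GRing.Theory Num.Theory.

(** * Independent sets in bipartite graphs *)

Section BigraphIndependence.
Variables (V1 V2 : finType) (B : bigraph V1 V2).

Lemma adjacent_bigraphE (u v : V1 + V2) :
  adjacent (sgraph_of_bigraph B) u v =
    match u, v with
    | inl x, inr y | inr y, inl x => (x, y) \in B
    | _, _ => false
    end.
Proof.
have lr x y : (x, y) \in B = ([set inl x; inr y] \in bigraph_edges B).
  apply/idP/imsetP=> [xyB|[[x' y'] xyB /setP eq_e]]; first by exists (x, y).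
  have /[!inE]/= := eq_e (inl x); have /[!inE]/= := eq_e (inr y).
  rewrite !eqxx /= => /esym/eqP[->] /esym; rewrite orbF => /eqP[->].
  exact: xyB.
rewrite /adjacent /=; case: u v => [x|y] [x'|y'] //.
- apply/imsetP=> -[[a b] _ /setP/(_ (inr b))]; by rewrite !inE eqxx orbT.
- by rewrite setUC.
- apply/imsetP=> -[[a b] _ /setP/(_ (inl a))]; by rewrite !inE eqxx.
Qed.

Lemma independent_bigraphP (A : {set V1}) (C : {set V2}) :
  reflect {in A & C, forall x y, (x, y) \notin B}
    (independent (sgraph_of_bigraph B) (inl @: A :|: inr @: C)).
Proof.
apply: (iffP forall_inP) => [indep x y xA yC|indep u uAC].
  have /forall_inP nadj : [forall v in inl @: A :|: inr @: C,
      ~~ adjacent (sgraph_of_bigraph B) (inl x) v].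
    by apply: indep; rewrite inE imset_f.
  by have := nadj (inr y); rewrite adjacent_bigraphE inE imset_f ?orbT //;
    apply.
apply/forall_inP=> v vAC; rewrite adjacent_bigraphE.
move: uAC vAC; rewrite !inE => /orP[]/imsetP[x xA ->] /orP[]/imsetP[y yA ->] //.
  exact: indep.
exact: indep.
Qed.

Lemma card_sumset (A : {set V1}) (C : {set V2}) :
  #|(inl @: A :|: inr @: C : {set V1 + V2})| = #|A| + #|C|.
Proof.
rewrite cardsU !card_imset; try by move=> ? ? [].
rewrite (_ : _ :&: _ = set0) ?cards0 ?subn0 //; apply/setP=> u; rewrite !inE.
by apply/negP=> /andP[/imsetP[x _ ->] /imsetP[y _]].
Qed.

Lemma alpha_ge_pair (A : {set V1}) (C : {set V2}) :
  independent (sgraph_of_bigraph B) (inl @: A :|: inr @: C) ->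
  #|A| + #|C| <= alpha (sgraph_of_bigraph B).
Proof.
by move=> indAC; rewrite -card_sumset /alpha (bigD1 _ indAC) /= leq_maxl.
Qed.

Lemma alpha_le_pair k :
  (forall (A : {set V1}) (C : {set V2}),
     independent (sgraph_of_bigraph B) (inl @: A :|: inr @: C) ->
     #|A| + #|C| <= k) ->
  alpha (sgraph_of_bigraph B) <= k.
Proof.
move=> le_k; apply/bigmax_leqP=> S.
have <- : inl @: (inl @^-1: S) :|: inr @: (inr @^-1: S) = S.
  apply/setP=> -[x|y]; rewrite !inE /=.
    rewrite mem_imset ?inE; last by move=> ? ? [].
    by rewrite orbC; case: imsetP => [[]|].
  rewrite orbC mem_imset ?inE; last by move=> ? ? [].
  by rewrite orbC; case: imsetP => [[]|].
by rewrite card_sumset; apply: le_k.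
Qed.

Lemma alpha_bal_ge_pair (A : {set V1}) (C : {set V2}) :
  #|A| = #|C| ->
  independent (sgraph_of_bigraph B) (inl @: A :|: inr @: C) ->
  #|A| + #|C| <= alpha_bal B.
Proof.
move=> eqAC indAC; have balAC : balanced_independent B (A, C).
  by rewrite /balanced_independent /= eqAC eqxx.
by rewrite /alpha_bal (bigD1 _ balAC) /= leq_maxl.
Qed.

Lemma alpha_bal_le : alpha_bal B <= alpha (sgraph_of_bigraph B).
Proof. by apply/bigmax_leqP=> P /andP[_]; apply: alpha_ge_pair. Qed.

End BigraphIndependence.

Section Relabel.
Variables (V1 V2 W1 W2 : finType) (B : bigraph V1 V2) (B' : bigraph W1 W2).
Variables (f1 : V1 -> W1) (f2 : V2 -> W2).
Hypotheses (f1_inj : injective f1) (f2_inj : injective f2).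
Hypothesis compat : forall x y, ((f1 x, f2 y) \in B') = ((x, y) \in B).

Lemma independent_relabel (A : {set V1}) (C : {set V2}) :
  independent (sgraph_of_bigraph B) (inl @: A :|: inr @: C) ->
  independent (sgraph_of_bigraph B') (inl @: (f1 @: A) :|: inr @: (f2 @: C)).
Proof.
move/independent_bigraphP=> ind; apply/independent_bigraphP.
by move=> _ _ /imsetP[x xA ->] /imsetP[y yC ->]; rewrite compat ind.
Qed.

Lemma alpha_relabel_le :
  alpha (sgraph_of_bigraph B) <= alpha (sgraph_of_bigraph B').
Proof.
apply: alpha_le_pair => A C indAC.
rewrite -(card_imset A f1_inj) -(card_imset C f2_inj).
exact/alpha_ge_pair/independent_relabel.
Qed.

Lemma alpha_bal_relabel_le : alpha_bal B <= alpha_bal B'.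
Proof.
apply/bigmax_leqP=> -[A C] /andP[/= /eqP eqAC indAC].
rewrite -(card_imset A f1_inj) -(card_imset C f2_inj).
apply: alpha_bal_ge_pair; last exact: independent_relabel.
by rewrite (card_imset A f1_inj) (card_imset C f2_inj).
Qed.

End Relabel.

Lemma balanced_relabel (V1 V2 W1 W2 : finType)
    (B : bigraph V1 V2) (B' : bigraph W1 W2) (f1 : V1 -> W1) (f2 : V2 -> W2) :
  bijective f1 -> bijective f2 ->
  (forall x y, ((f1 x, f2 y) \in B') = ((x, y) \in B)) ->
  alpha (sgraph_of_bigraph B) = alpha_bal B <->
  alpha (sgraph_of_bigraph B') = alpha_bal B'.
Proof.
move=> [g1 fK1 gK1] [g2 fK2 gK2] compat.
have compat' x y : ((g1 x, g2 y) \in B) = ((x, y) \in B').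
  by rewrite -compat gK1 gK2.
have -> : alpha (sgraph_of_bigraph B) = alpha (sgraph_of_bigraph B').
  apply/eqP; rewrite eqn_leq.
  by rewrite !(alpha_relabel_le _ _ compat, alpha_relabel_le _ _ compat') //;
    exact: can_inj.
suff -> : alpha_bal B = alpha_bal B' by [].
apply/eqP; rewrite eqn_leq.
by rewrite !(alpha_bal_relabel_le _ _ compat,
  alpha_bal_relabel_le _ _ compat') //; exact: can_inj.
Qed.

(** * Balanced independent sets of the graph H_G *)

Section HalfClique.
Variables (V : finType) (G : sgraph V).
Local Notation n := #|V|.
Local Notation m := #|edges G|.

(** The hypothesis on |E| with denominators and subtraction cleared, so that
    the counting can be done in natural numbers. *)
Lemma quarter_edgesE : quarter_edges G = (4 * m + 2 * n == n * n).
Proof.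
rewrite /quarter_edges.
have -> : (4^-1 * n%:R * (n%:R - 2) = ((n * n)%:R - (2 * n)%:R) / 4 :> rat)%R.
  by rewrite !natrM; field.
rewrite eq_sym -(inj_eq (mulIf (_ : (4 : rat) != 0)%R)) // divfK //.
rewrite subr_eq eq_sym -natrM -natrD eqr_nat mulnC; by [].
Qed.

Lemma clique_sub (C D : {set V}) : D \subset C -> clique G C -> clique G D.
Proof.
move=> /subsetP sDC /forall_inP clC; apply/forall_inP=> u /sDC uC.
by apply/forall_inP=> v /sDC vC; move/forall_inP: (clC u uC); apply.
Qed.

Lemma edge_card2 (e : {set V}) : e \in edges G -> #|e| = 2.
Proof. by move=> eG; apply/eqP; move/forall_inP: (edges_card2 G); apply. Qed.

Lemma clique_edgesP (C : {set V}) :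
  reflect (forall e : {set V}, e \subset C -> #|e| = 2 -> e \in edges G)
    (clique G C).
Proof.
apply: (iffP forall_inP) => [clC e eC /eqP/cards2P|sub u uC].
  move=> [u [v [neq_uv def_e]]].
  have uC : u \in C by apply: (subsetP eC); rewrite def_e !inE eqxx.
  have vC : v \in C by apply: (subsetP eC); rewrite def_e !inE eqxx orbT.
  have /forall_inP/(_ v vC) := clC u uC.
  by rewrite neq_uv def_e.
apply/forall_inP=> v vC; apply/implyP=> neq_uv; apply: sub.
  by apply/subsetP=> w /set2P[] ->.
by rewrite cards2 neq_uv.
Qed.

Lemma card_edges_in_le (C : {set V}) :
  #|edges G :&: powerset C| <= 'C(#|C|, 2).
Proof.
rewrite -(cards_draws C 2); apply: subset_leq_card; apply/subsetP=> e.
by rewrite !inE => /andP[/edge_card2-> ->].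
Qed.

Lemma card_edge_type : #|{: edge_type G}| = m.
Proof. by rewrite card_sig. Qed.

(** A set of k vertices spans at most as many edges as it has 2-element
    subsets, so counting the edges it spans is enough to detect a clique. *)
Lemma clique_card_edgesP (C : {set V}) :
  reflect ('C(#|C|, 2) <= #|edges G :&: powerset C|) (clique G C).
Proof.
pose D := [set e : {set V} | e \subset C & #|e| == 2].
have sED : edges G :&: powerset C \subset D.
  by apply/subsetP=> e /[!inE] /andP[/edge_card2-> ->].
rewrite -(cards_draws C 2) -/D; apply: (iffP (clique_edgesP C)) => [clC|leD].
  apply: subset_leq_card; apply/subsetP=> e /[!inE] /andP[eC /eqP e2].
  by rewrite eC clC.
have eqED : edges G :&: powerset C = D.
  by apply/eqP; rewrite eqEcard sED.
move=> e eC e2; have : e \in D by rewrite inE eC e2.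
by rewrite -eqED inE => /andP[].
Qed.

(** Both sides of H_G are the same type, so a subset of it can be taken on the
    left and its complement on the right; that pair is independent precisely
    when no edge leaves the subset. *)
Definition HG_closed (A : {set HG_side G}) : Prop :=
  forall x y, x \in A -> HG_adj x y -> y \in A.

Lemma HG_adj_refl (x : HG_side G) : HG_adj x x.
Proof. by case: x => [v|[e i]] /=. Qed.

(** Reflexivity of adjacency makes the two halves of an independent set
    disjoint subsets of one side; one full side attains the bound. *)
Lemma alpha_HG : alpha (sgraph_of_bigraph (HG G)) = #|{: HG_side G}|.
Proof.
apply/eqP; rewrite eqn_leq; apply/andP; split.
  apply: alpha_le_pair => A C /independent_bigraphP indAC.
  rewrite -cardsUI (_ : A :&: C = set0) ?cards0 ?addn0 ?max_card //.
  apply/setP=> x; rewrite !inE; apply/negP=> /andP[xA xC].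
  by have := indAC x x xA xC; rewrite inE HG_adj_refl.
have := @alpha_ge_pair _ _ (HG G) setT set0; rewrite cardsT cards0 addn0; apply.
by apply/independent_bigraphP=> x y _; rewrite inE.
Qed.

(** A balanced independent set of maximum size partitions the common type of
    the two sides into two halves of equal size. *)
Lemma alpha_bal_HGP :
  alpha (sgraph_of_bigraph (HG G)) = alpha_bal (HG G) <->
  exists2 A : {set HG_side G}, 2 * #|A| = #|{: HG_side G}| & HG_closed A.
Proof.
split=> [eq_alpha|[A A2 clA]]; last first.
  have cA : #|A| = #|~: A|.
    by apply/eqP; rewrite -(eqn_add2l #|A|) cardsC -A2 addnn mul2n.
  apply/eqP; rewrite eqn_leq alpha_bal_le alpha_HG andbT -A2 mul2n -addnn.
  rewrite {2}cA; apply: alpha_bal_ge_pair => //.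
  apply/independent_bigraphP=> x y xA; rewrite !inE; apply: contra.
  exact: clA.
have bal0 : balanced_independent (HG G) (set0, set0).
  rewrite /balanced_independent /= !cards0 eqxx.
  by apply/independent_bigraphP=> x y; rewrite inE.
have [[A C] /andP[/= /eqP eqAC /independent_bigraphP indAC] defmax] :=
  eq_bigmax_cond
    (fun Q : {set HG_side G} * {set HG_side G} => #|Q.1| + #|Q.2|)
    (introT card_gt0P (ex_intro (fun P => P \in balanced_independent (HG G))
       _ bal0)).
have cardAC : #|A| + #|C| = #|{: HG_side G}|.
  rewrite -alpha_HG eq_alpha; exact/esym.
have defC : C = ~: A.
  apply/eqP; rewrite eqEcard -[leqLHS](addKn #|A|) cardsC -cardAC addKn leqnn.
  rewrite andbT; apply/subsetP=> x xC; rewrite inE; apply/negP=> xA.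
  by have := indAC x x xA xC; rewrite inE HG_adj_refl.
exists A; first by rewrite -cardAC -eqAC addnn mul2n.
move=> x y xA xy; apply/negPn/negP=> yA.
by have /[!inE] := indAC x y xA; rewrite xy defC inE => /(_ yA).
Qed.

Definition block_union (S : {set V}) (D : {set edge_type G}) :
    {set HG_side G} :=
  inl @: S :|: inr @: setX D [set: 'I_n.+1].

Lemma card_block_union S D : #|block_union S D| = #|S| + #|D| * n.+1.
Proof. by rewrite card_sumset cardsX cardsT card_ord. Qed.

Lemma mem_block_unionl S D v : (inl v \in block_union S D) = (v \in S).
Proof.
rewrite inE mem_imset; last by move=> ? ? [].
by rewrite orbC; case: imsetP => [[]|].
Qed.

Lemma mem_block_unionr S D e i : (inr (e, i) \in block_union S D) = (e \in D).
Proof.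
rewrite inE orbC mem_imset; last by move=> ? ? [].
by rewrite !inE andbT orbC; case: imsetP => [[]|].
Qed.

(** All vertices of L_e are adjacent to all of R_e, so a closed set contains a
    block entirely or not at all. *)
Lemma HG_closedP (A : {set HG_side G}) :
  HG_closed A <-> exists S D, A = block_union S D /\
    forall v (e : edge_type G), v \in S -> v \in val e -> e \in D.
Proof.
split=> [clA|[S [D [-> sSD]]]]; last first.
  move=> [v|[e i]] [w|[f j]] //=; rewrite ?mem_block_unionl ?mem_block_unionr.
  - by move=> ? /eqP <-.
  - exact: sSD.
  - by move=> ? /eqP <-.
exists [set v | inl v \in A], [set e | inr (e, ord0) \in A]; split; last first.
  by move=> v e /[!inE] vA ve; apply: clA vA _.
apply/setP=> -[v|[e i]]; rewrite ?mem_block_unionl ?mem_block_unionr inE //.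
by apply/idP/idP=> eA; apply: clA eA _ => /=.
Qed.

Lemma card_HG_side : #|{: HG_side G}| = n + m * n.+1.
Proof. by rewrite card_sum card_prod card_ord card_sig. Qed.

(** The complement of the vertex set S of a balanced closed set is the clique,
    and the edges outside D are the edges it spans. *)
Lemma half_clique_balanced : quarter_edges G ->
  (exists2 C, clique G C & 2 * #|C| = n) <->
  alpha (sgraph_of_bigraph (HG G)) = alpha_bal (HG G).
Proof.
rewrite quarter_edgesE => /eqP nm; rewrite alpha_bal_HGP card_HG_side.
have m_bin (C : {set V}) : 2 * #|C| = n -> m = 2 * 'C(#|C|, 2).
  move=> C2; have := nm; rewrite -C2 -mul_bin_diag bin1.
  by case: #|C| => [|c] /=; nia.
have card_in (C : {set V}) : #|edges G :&: powerset C| =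
    #|[set e : edge_type G | val e \subset C]|.
  rewrite -[RHS](card_imset _ val_inj); apply: eq_card => e; rewrite !inE.
  apply/andP/imsetP=> [[eG eC]|[f /[!inE] fC ->]]; last by rewrite (valP f).
  by exists (Sub e eG); rewrite ?inE.
split=> [[C clC C2]|[A A2 /HG_closedP[S [D [defA sSD]]]]].
  pose D := [set e : edge_type G | ~~ (val e \subset C)].
  exists (block_union (~: C) D); last first.
    apply/HG_closedP; exists (~: C), D.
    split=> // v e /[!inE] vC ve.
    by apply: contra vC => /subsetP; apply.
  have -> : D = ~: [set e : edge_type G | val e \subset C].
    by apply/setP=> e; rewrite !inE.
  have in_half : #|[set e : edge_type G | val e \subset C]| = 'C(#|C|, 2).
    rewrite -card_in; apply/eqP; rewrite eqn_leq card_edges_in_le.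
    exact/clique_card_edgesP.
  rewrite card_block_union mulnDr mulnA; congr (_ + _ * _).
    by have := cardsC C; lia.
  have := cardsC [set e : edge_type G | val e \subset C].
  by rewrite in_half card_edge_type (m_bin C C2) mul2n -addnn => /addnI ->;
    rewrite mul2n addnn.
move: A2; rewrite defA card_block_union => A2.
(* 2|S| and n differ by a multiple of n + 1, and by at most n as |S| <= n. *)
have [S2 D2] : 2 * #|S| = n /\ 2 * #|D| = m.
  have := max_card S; rewrite -/n => Sn.
  have : 2 * #|D| = m by nia.
  by nia.
have C2 : 2 * #|~: S| = n by have := cardsC S; lia.
exists (~: S) => //; apply/clique_card_edgesP; rewrite card_in.
have sDin : ~: D \subset [set e : edge_type G | val e \subset ~: S].
  apply/subsetP=> e /[!inE] eD; apply/subsetP=> v ve; rewrite inE.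
  by apply: contra eD => vS; apply: sSD ve.
apply: leq_trans (subset_leq_card sDin).
by have := cardsC D; rewrite card_edge_type; have := m_bin _ C2; lia.
Qed.

Lemma omega_half_cliqueP : quarter_edges G ->
  (#|V|%:R / 2 <= (omega G)%:R :> rat)%R <->
  exists2 C, clique G C & 2 * #|C| = n.
Proof.
rewrite quarter_edgesE => /eqP nm.
have -> : (n%:R / 2 <= (omega G)%:R :> rat)%R = (n <= omega G * 2).
  by rewrite ler_pdivrMr // -natrM ler_nat.
have n2 : n = 2 * n./2.
  have even_n : ~~ odd n.
    by have := congr1 odd nm; rewrite oddD !oddM /= andbb => <-.
  by rewrite mul2n even_halfK.
split=> [le_n|[C clC <-]]; last first.
  by rewrite mulnC leq_mul2r /omega (bigD1 _ clC) /= leq_maxl.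
have cl0 : clique G set0 by apply/forall_inP=> u; rewrite inE.
have [C clC defC] := eq_bigmax_cond (fun C : {set V} => #|C|)
  (introT card_gt0P (ex_intro (fun C => C \in clique G) _ cl0)).
have leC : n./2 <= #|C| by rewrite /omega defC in le_n; lia.
have /card_geqP[s [uniq_s size_s sub_s]] := leC.
exists [set v in s].
  by apply: clique_sub clC; apply/subsetP=> v /[!inE] /sub_s.
by rewrite cardsE (card_uniqP uniq_s) size_s.
Qed.
End HalfClique.

(** * Turing machines from program fragments *)

Section Fragments.
Variable T : finType.

Definition store := ((T -> nat -> symbol) * (T -> nat))%type.
Definition reading := {ffun T -> symbol}.
Definition action := {ffun T -> symbol * move}.

Definition read (s : store) : reading := [ffun t => s.1 t (s.2 t)].

Definition act (a : action) (s : store) : store :=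
  (fun t i => if i == s.2 t then (a t).1 else s.1 t i,
   fun t => shift (a t).2 (s.2 t)).

Definition idle (r : reading) : action := [ffun t => (r t, Stay)].

(** A fragment is the control of a machine with one exit: [next] answers [None]
    in place of a successor state when control leaves the fragment. *)
Record fragment := Fragment {
  fstate : finType;
  entry : fstate;
  next : fstate -> reading -> option fstate * action }.

Definition fconfig (F : fragment) := (option (fstate F) * store)%type.

Definition fstep (F : fragment) (c : fconfig F) : fconfig F :=
  if c.1 is Some q then
    let: (q', a) := next q (read c.2) in (q', act a c.2)
  else c.

(** A bound on the number of steps instead of their exact number, so that costs
    can be rounded up. *)
Definition reaches (F : fragment) (c c' : fconfig F) (k : nat) : Prop :=
  exists2 i, i <= k & iter i (@fstep F) c = c'.

Lemma reaches_refl F (c : fconfig F) : reaches c c 0.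
Proof. by exists 0. Qed.

Lemma reaches_trans F (c1 c2 c3 : fconfig F) k l :
  reaches c1 c2 k -> reaches c2 c3 l -> reaches c1 c3 (k + l).
Proof.
move=> [i ik <-] [j jl <-]; exists (j + i); last by rewrite iterD.
by rewrite addnC leq_add.
Qed.

Lemma reaches_step F (c1 c2 : fconfig F) k :
  reaches (fstep c1) c2 k -> reaches c1 c2 k.+1.
Proof. by move=> [i ik <-]; exists i.+1; rewrite ?iterSr. Qed.

Lemma reaches_le F (c1 c2 : fconfig F) k l :
  k <= l -> reaches c1 c2 k -> reaches c1 c2 l.
Proof. by move=> kl [i ik <-]; exists i; rewrite ?(leq_trans ik). Qed.

(** Control structures place the states of a fragment inside a larger one and
    redirect its exit to the state [out]; its runs are unchanged up to the
    moment it exits. *)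
Lemma reaches_embed (F G : fragment) (emb : fstate F -> fstate G) out :
  (forall q r, next (emb q) r =
     let: (q', a) := next q r in
     (if q' is Some p then Some (emb p) else out, a)) ->
  forall q s s' k, reaches (Some q, s) (None, s') k ->
    reaches (Some (emb q), s) (out, s') k.
Proof.
move=> embP q s s' k [i ik]; elim: i k q s ik => [|i IHi] [|k] q s //= ik.
rewrite -iterS iterSr /= {2}/fstep /=; case E: (next q (read s)) => [q' a] eq_c.
apply: reaches_step; rewrite /fstep /= embP E.
case: q' E eq_c => [p|] E eq_c; first exact: (IHi k).
have -> : act a s = s'.
  have fix_exit j (c : store) : iter j (@fstep F) (None, c) = (None, c).
    by elim: j => //= j ->.
  by have := eq_c; rewrite fix_exit => -[].
exact: reaches_le (reaches_refl _).
Qed.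

(** Total correctness with a time bound: from a store satisfying [P], the
    fragment exits within [k] steps in a store satisfying [Q]. *)
Definition triple (P : store -> Prop) F (Q : store -> Prop) (k : nat) : Prop :=
  forall s, P s -> exists2 s', Q s' & reaches (Some (entry F), s) (None, s') k.

Lemma triple_weaken (P P' Q Q' : store -> Prop) F k l :
  (forall s, P' s -> P s) -> (forall s, Q s -> Q' s) -> k <= l ->
  triple P F Q k -> triple P' F Q' l.
Proof.
move=> PP' QQ' kl tF s /PP'/tF[s' /QQ' Qs' run].
by exists s'; last exact: reaches_le run.
Qed.

Definition prim (g : reading -> action) : fragment :=
  @Fragment unit tt (fun _ r => (None, g r)).

Lemma triple_prim (P Q : store -> Prop) g :
  (forall s, P s -> Q (act (g (read s)) s)) -> triple P (prim g) Q 1.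
Proof.
move=> PQ s Ps; exists (act (g (read s)) s); first exact: PQ.
by apply: reaches_step; exact: reaches_refl.
Qed.

Definition seq_frag (F1 F2 : fragment) : fragment :=
  @Fragment (fstate F1 + fstate F2)%type (inl (entry F1))
    (fun q r => match q with
     | inl q1 => let: (q', a) := next q1 r in
         (Some (if q' is Some p then inl p else inr (entry F2)), a)
     | inr q2 => let: (q', a) := next q2 r in (omap inr q', a)
     end).

Lemma triple_seq (P Q R : store -> Prop) F1 F2 k l :
  triple P F1 Q k -> triple Q F2 R l -> triple P (seq_frag F1 F2) R (k + l).
Proof.
move=> t1 t2 s /t1[s1 /t2[s2 Rs2 run2] run1]; exists s2 => //.
apply: (@reaches_trans (seq_frag F1 F2) _
  (Some (inr (entry F2) : fstate (seq_frag F1 F2)), s1)).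
  apply: (reaches_embed (F := F1) (G := seq_frag F1 F2)
    (emb := inl) (out := Some (inr _)) _ run1).
  by move=> q r /=; case: (next q r) => -[].
apply: (reaches_embed (F := F2) (G := seq_frag F1 F2)
  (emb := inr) (out := None) _ run2).
by move=> q r /=; case: (next q r) => -[].
Qed.

Definition ite_frag (p : pred reading) (F1 F2 : fragment) : fragment :=
  @Fragment (option (fstate F1 + fstate F2)) None
    (fun q r => match q with
     | None => (Some (Some (if p r then inl (entry F1) else inr (entry F2))),
                idle r)
     | Some (inl q1) => let: (q', a) := next q1 r in (omap (Some \o inl) q', a)
     | Some (inr q2) => let: (q', a) := next q2 r in (omap (Some \o inr) q', a)
     end).

Definition while_frag (p : pred reading) (F : fragment) : fragment :=
  @Fragment (option (fstate F)) None
    (fun q r => match q with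
     | None => (if p r then Some (Some (entry F)) else None, idle r)
     | Some q1 => let: (q', a) := next q1 r in (Some q', a)
     end).

Definition eq_store (s s' : store) : Prop :=
  (forall t i, s.1 t i = s'.1 t i) /\ s.2 =1 s'.2.

(** A step that only reads still writes each symbol back, and the new cells
    agree with the old ones pointwise.  Assertions that cannot tell such stores
    apart survive the test steps of branches and loops. *)
Definition extensional (P : store -> Prop) : Prop :=
  forall s s', eq_store s s' -> P s -> P s'.

Lemma act_idle s : eq_store s (act (idle (read s)) s).
Proof.
by split=> [t i|t] /=; rewrite !ffunE //=; case: eqP => // ->.
Qed.

Lemma triple_ite (P Q : store -> Prop) (p : pred reading) F1 F2 k :
  extensional P ->
  triple (fun s => P s /\ p (read s)) F1 Q k ->
  triple (fun s => P s /\ ~~ p (read s)) F2 Q k ->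
  triple P (ite_frag p F1 F2) Q k.+1.
Proof.
move=> extP t1 t2 s Ps; set s1 := act (idle (read s)) s.
have Ps1 : P s1 by apply: extP Ps; exact: act_idle.
have eq_read : read s1 = read s.
  have [eqc eqh] := act_idle s.
  by apply/ffunP=> t; rewrite !ffunE -/s1 -eqh -eqc.
case: (boolP (p (read s))) => ps.
  have [|s2 Qs2 run] := t1 s1; first by rewrite eq_read.
  exists s2 => //; apply: reaches_step; rewrite /fstep /= ps -/s1.
  apply: (reaches_embed (F := F1) (G := ite_frag p F1 F2)
    (emb := Some \o inl) (out := None) _ run).
  by move=> q r /=; case: (next q r) => -[].
have [|s2 Qs2 run] := t2 s1; first by rewrite eq_read.
exists s2 => //; apply: reaches_step; rewrite /fstep /= (negbTE ps) -/s1.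
apply: (reaches_embed (F := F2) (G := ite_frag p F1 F2)
  (emb := Some \o inr) (out := None) _ run).
by move=> q r /=; case: (next q r) => -[].
Qed.

(** The invariant is indexed by the number of completed rounds, which is known
    beforehand for every loop below; each round costs one more step, for its
    test, and so does the final failing test. *)
Lemma triple_while (I : nat -> store -> Prop) (p : pred reading) F N k :
  (forall i, extensional (I i)) ->
  (forall i s, i < N -> I i s -> p (read s)) ->
  (forall s, I N s -> ~~ p (read s)) ->
  (forall i, i < N -> triple (I i) F (I i.+1) k) ->
  triple (I 0) (while_frag p F) (I N) (N * k.+1 + 1).
Proof.
move=> extI pI pN tF; suff rec j : forall i, i + j = N ->
    triple (I i) (while_frag p F) (I N) (j * k.+1 + 1) by exact: rec.
elim: j => [|j IHj] i defN s Is.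
  rewrite addn0 in defN; rewrite defN in Is.
  exists (act (idle (read s)) s); first by apply: extI Is; exact: act_idle.
  apply: reaches_step; rewrite /fstep /= (negbTE (pN _ Is)).
  exact: reaches_refl.
have iN : i < N by lia.
set s1 := act (idle (read s)) s.
have [|s2 Is2 run] := tF i iN s1; first by apply: extI Is; exact: act_idle.
have [|s3 Is3 run'] := IHj i.+1 _ s2 Is2; first by lia.
exists s3 => //.
rewrite (_ : j.+1 * k.+1 + 1 = (k + (j * k.+1 + 1)).+1); last by lia.
apply: reaches_step.
rewrite {1}/fstep /= (pI i) // -/s1; apply: reaches_trans run'.
apply: (reaches_embed (F := F) (G := while_frag p F)
  (emb := Some) (out := Some None) _ run).
by move=> q r /=; case: (next q r) => -[].
Qed.

(** Control outside the fragment is the halting state. *)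
Definition machine_of (F : fragment) (inp out : T) : machine :=
  @Machine (option (fstate F)) T (Some (entry F)) (fun q => ~~ q) inp out
    (fun q r => if q is Some p then next p r else (None, idle r)).

Definition init_store (inp : T) (w : seq bool) : store :=
  (fun t => word_cells (if t == inp then w else [::]), fun=> 0).

Lemma machine_ofP F inp out w w' k (P : store -> Prop) :
  triple P F (fun s => s.1 out =1 word_cells w') k -> P (init_store inp w) ->
  outputs_within (machine_of F inp out) w k w'.
Proof.
move=> tF /tF[s' outE [i ik run]].
pose conf (c : fconfig F) : config (machine_of F inp out) :=
  @Config (machine_of F inp out) c.1 c.2.1 c.2.2.
have stepE c : step (conf c) = conf (fstep c).
  by case: c => -[q|] s //; rewrite /step /fstep /=; case: (next q _).
have iterE j c : iter j (@step _) (conf c) = conf (iter j (@fstep F) c).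
  by elim: j => //= j ->; rewrite stepE.
rewrite /outputs_within -(subnK ik) iterD.
rewrite (_ : init_config _ _ = conf (Some (entry F), init_store inp w)) //.
rewrite iterE run.
by have -> : iter (k - i) (@step _) (conf (None, s')) = conf (None, s');
  first by elim: (k - i) => //= j ->.
Qed.

End Fragments.

(** * Programs over unary counters *)

(** Besides the input and output tapes there are three counters for the row
    vertex, three for the column vertex, one for the columns skipped in a matrix
    lookup ([scan]), and one that records how far heads were moved
    ([scratch]). *)
Definition tapes : finType := 'I_10.
Definition inp : tapes := @Ordinal 10 0 isT.
Definition out : tapes := @Ordinal 10 1 isT.
Definition scan : tapes := @Ordinal 10 2 isT.
Definition scratch : tapes := @Ordinal 10 3 isT.
Definition row1 : tapes := @Ordinal 10 4 isT.
Definition row2 : tapes := @Ordinal 10 5 isT.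
Definition row3 : tapes := @Ordinal 10 6 isT.
Definition col1 : tapes := @Ordinal 10 7 isT.
Definition col2 : tapes := @Ordinal 10 8 isT.
Definition col3 : tapes := @Ordinal 10 9 isT.

Definition nonstart (t : tapes) (r : reading tapes) : bool :=
  if r t is Start then false else true.

Definition one (t : tapes) (r : reading tapes) : bool :=
  if r t is Bit b then b else false.

Definition dir (ls rs : seq tapes) (t : tapes) : move :=
  if t \in ls then Left else if t \in rs then Right else Stay.

(** Closed form of the head positions after [k] rounds; the truncated
    subtraction is the behaviour of a head stopped by the leftmost cell. *)
Definition heads_after (ls rs : seq tapes) (k : nat) (h : tapes -> nat)
    (t : tapes) : nat :=
  match dir ls rs t with Left => h t - k | Stay => h t | Right => h t + k end.

Definition upd (h : tapes -> nat) (t : tapes) (v : nat) (u : tapes) : nat :=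
  if u == t then v else h u.

Definition go (ls rs : seq tapes) : fragment tapes :=
  prim (fun r => [ffun t => (r t, dir ls rs t)]).

Definition emit (b : bool) : fragment tapes :=
  prim (fun r => [ffun t => if t == out then (Bit b, Right) else (r t, Stay)]).

Definition skip : fragment tapes := go [::] [::].

Definition walk (p : pred (reading tapes)) (ls rs : seq tapes) :
    fragment tapes :=
  while_frag p (go ls rs).

Definition rewind (t : tapes) : fragment tapes := walk (nonstart t) [:: t] [::].

(** The head of [t] steps through the ones of its tape and returns to the left
    end.  The i-th round, counted from 0, runs with that head on cell i + 1. *)
Definition for_each (t : tapes) (F : fragment tapes) : fragment tapes :=
  seq_frag (go [::] [:: t])
    (seq_frag (while_frag (one t) (seq_frag F (go [::] [:: t]))) (rewind t)).

(** Both heads walk left until one of them reaches the left end, while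
    [scratch] counts the steps; the head of [x] is among those that have arrived
    iff its position was at most that of [y].  The walk back restores the
    positions before the branch is executed. *)
Definition if_le (x y : tapes) (F1 F2 : fragment tapes) : fragment tapes :=
  let back := walk (nonstart scratch) [:: scratch] [:: x; y] in
  seq_frag (walk (fun r => nonstart x r && nonstart y r) [:: x; y] [:: scratch])
    (ite_frag (nonstart x) (seq_frag back F2) (seq_frag back F1)).

Definition if_lt x y F1 F2 := if_le y x F2 F1.

Definition if_eq x y F1 F2 := if_le x y (if_le y x F1 F2) F2.

(** Lookup of the matrix entry addressed by the heads of [x] and [y].  The head
    of the input starts on cell 1 and moves by n cells, counted by [scan], for
    every cell between the head of [x] and the left end, and then by one cell
    for each such cell of [y].  With the heads on cells a + 1 and b + 1 it
    arrives at cell 1 + (a + 1) n + (b + 1) = (n + 2) + a n + b, which is the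
    entry (a, b), since the entries start right after the n ones and the 0 that
    separates them from the matrix. *)
Definition if_adj (x y : tapes) (F1 F2 : fragment tapes) : fragment tapes :=
  seq_frag (go [::] [:: inp])
 (seq_frag (while_frag (nonstart x)
    (seq_frag (go [:: x] [:: scratch; scan])
    (seq_frag (walk (one scan) [::] [:: scan; inp]) (rewind scan))))
 (seq_frag (walk (nonstart scratch) [:: scratch] [:: x])
 (seq_frag (walk (nonstart y) [:: y] [:: scratch; inp])
 (seq_frag (walk (nonstart scratch) [:: scratch] [:: y])
 (ite_frag (one inp) (seq_frag (rewind inp) F1) (seq_frag (rewind inp) F2)))))).

(** Visits one side of H_G.  The end points of an edge are visited in increasing
    order only, so that no edge comes twice.  The members of a block are
    indistinguishable by adjacency, so [Fe] is merely repeated; the loop on [c]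
    accounts for n of the n + 1 members. *)
Definition vertices (a b c : tapes) (Fv Fe : fragment tapes) : fragment tapes :=
  seq_frag (for_each a Fv)
    (for_each a (for_each b (if_lt a b
       (if_adj a b (seq_frag Fe (for_each c Fe)) skip) skip))).

(** The size of a side is never computed: each vertex contributes a one to its
    unary notation. *)
Definition header : fragment tapes :=
  seq_frag (vertices row1 row2 row3 (emit true) (emit true)) (emit false).

Definition test_eq x y : fragment tapes := if_eq x y (emit true) (emit false).

(** The outer traversal selects the row and the inner one the column.  Both
    visit actual edges only, so adjacency in H_G reduces to comparisons of
    end points. *)
Definition body : fragment tapes :=
  vertices row1 row2 row3
    (vertices col1 col2 col3 (test_eq row1 col1)
       (if_eq row1 col1 (emit true) (test_eq row1 col2)))
    (vertices col1 col2 col3 (emit false)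
       (if_eq row1 col1 (test_eq row2 col2) (emit false))).

(** Copies the leading ones of the input to all counters simultaneously, then
    brings all heads but that of the output back to the left end. *)
Definition setup : fragment tapes :=
  seq_frag (prim (fun r => [ffun t => (r t, Right)]))
 (seq_frag (while_frag (one inp)
    (prim (fun r => [ffun t => if t == out then (r t, Stay) else
                               (if t == inp then r t else Bit true, Right)])))
   (walk (nonstart inp) (inp :: rem out (enum tapes)) [::])).

Definition program : fragment tapes :=
  seq_frag setup (seq_frag header (seq_frag header body)).

(** Costs are polynomials in n composed like the programs themselves, so that a
    polynomial bound for the whole machine needs no estimate. *)
Definition for_each_cost (c : {poly nat}) : {poly nat} :=
  ('X * (c + 4%N%:P) + 5%N%:P)%R.

Definition if_le_cost (c1 c2 : {poly nat}) : {poly nat} :=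
  (c1 + c2 + (4%N%:P * 'X + 3%N%:P))%R.

Definition if_eq_cost (c1 c2 : {poly nat}) : {poly nat} :=
  if_le_cost (if_le_cost c1 c2) c2.

Definition if_adj_cost (c1 c2 : {poly nat}) : {poly nat} :=
  (c1 + c2 + (6%N%:P * 'X * 'X + 14%N%:P * 'X + 9%N%:P))%R.

Definition vertices_cost (cv ce : {poly nat}) : {poly nat} :=
  (for_each_cost cv + for_each_cost (for_each_cost
     (if_le_cost 1 (if_adj_cost (ce + for_each_cost ce) 1))))%R.

Definition header_cost : {poly nat} := (vertices_cost 1 1 + 1)%R.

Definition body_cost : {poly nat} :=
  vertices_cost
    (vertices_cost (if_eq_cost 1 1) (if_eq_cost 1 (if_eq_cost 1 1)))
    (vertices_cost 1 (if_eq_cost (if_eq_cost 1 1) 1)).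

Definition program_cost : {poly nat} :=
  (4%N%:P * 'X + 5%N%:P + (header_cost + (header_cost + body_cost)))%R.

(** What the counters know of a vertex of H_G: the vertex v of G that it
    copies, or the end points (a, b) of the edge to whose block it belongs.  All
    members of a block share one name. *)
Definition vertex_name := (nat + nat * nat)%type.

Definition name_adj (x y : vertex_name) : bool :=
  match x, y with
  | inl v, inl v' => v == v'
  | inl v, inr p => (v == p.1) || (v == p.2)
  | inr p, inr p' => p == p'
  | inr _, inl _ => false
  end.

Section Names.
Variables (n : nat) (adj : nat -> nat -> bool).

Definition edge_names : seq (nat * nat) :=
  [seq p <- [seq (a, b) | a <- iota 0 n, b <- iota 0 n] |
     (p.1 < p.2) && adj p.1 p.2].

Definition vertex_names : seq vertex_name :=
  [seq inl v | v <- iota 0 n] ++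
  [seq inr p | p <- edge_names, _ <- iota 0 n.+1].

End Names.

Lemma flatten_filter (S R : Type) (P : pred S) (F : S -> seq R) s :
  flatten [seq F x | x <- s & P x] =
  flatten [seq if P x then F x else [::] | x <- s].
Proof. by elim: s => //= x s <-; case: (P x). Qed.

Lemma flatten_allpairs (S S' R R' : Type) (f : S -> S' -> R) (F : R -> seq R')
    s s' :
  flatten [seq F z | z <- [seq f x y | x <- s, y <- s']] =
  flatten [seq flatten [seq F (f x y) | y <- s'] | x <- s].
Proof. by elim: s => //= x s <-; rewrite map_cat flatten_cat -map_comp. Qed.

Lemma flatten_map1 (S R : Type) (f : S -> R) s :
  flatten [seq [:: f x] | x <- s] = [seq f x | x <- s].
Proof. by elim: s => //= x s ->. Qed.

Section Programs.
Variable w : seq bool.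
Let n := index false w.

Definition tape_word (k : nat) (o : seq bool) (t : tapes) : seq bool :=
  if t == inp then w else if t == out then o else nseq k true.

(** The store described by the positions [h] of the heads and the output [o],
    when the work tapes hold [k] ones; the head of the output tape is tied to
    the length of [o], whatever [h] says there. *)
Definition rep (k : nat) (h : tapes -> nat) (o : seq bool) (s : store tapes) :
    Prop :=
  (forall t i, s.1 t i = word_cells (tape_word k o t) i) /\
  (forall t, s.2 t = if t == out then (size o).+1 else h t).

Lemma rep_extensional k h o : extensional (rep k h o).
Proof.
move=> s s' [eqc eqh] [repc reph].
by split=> [t i|t]; rewrite -?eqc -?eqh.
Qed.

Lemma rep_eq_heads k h h' o s : h =1 h' -> rep k h o s -> rep k h' o s.
Proof. by move=> eqh [repc reph]; split=> // t; rewrite reph eqh. Qed.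

Lemma nonstart_rep k h o s t :
  t != out -> rep k h o s -> nonstart t (read s) = (0 < h t).
Proof.
move=> tout [repc reph]; rewrite /nonstart ffunE repc reph (negbTE tout).
case: (h t) => //= i; elim: (tape_word _ _ _) i => [|b u IHu] [|i] //=.
by have := IHu i.
Qed.

Lemma one_rep k h o s t :
  t != out -> rep k h o s ->
  one t (read s) = nth false (false :: tape_word k o t) (h t).
Proof.
move=> tout [repc reph]; rewrite /one ffunE repc reph (negbTE tout).
case: (h t) => //= i; elim: (tape_word _ _ _) i => [|b u IHu] [|i] //=.
Qed.

Lemma one_counter k h o s t :
  t != inp -> t != out -> rep k h o s -> one t (read s) = (0 < h t <= k).
Proof.
move=> tinp tout reps; rewrite (one_rep tout reps) /tape_word.
rewrite (negbTE tinp) (negbTE tout); case: (h t) => //= i.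
by rewrite nth_nseq; case: ltnP.
Qed.

Local Notation moves k h o F h' o' c :=
  (triple (rep k h o) F (rep k h' o') c).

Lemma moves_eq_heads k h o F h1 h1' h' o' c :
  h =1 h1 -> h1' =1 h' -> moves k h1 o F h1' o' c -> moves k h o F h' o' c.
Proof.
move=> e1 e2; apply: triple_weaken => // s; exact: rep_eq_heads.
Qed.

Lemma moves_go k h o ls rs : out \notin ls -> out \notin rs ->
  moves k h o (go ls rs) (heads_after ls rs 1 h) o 1.
Proof.
move=> lso rso; apply: triple_prim => s [repc reph]; split=> [t i|t] /=.
  by rewrite !ffunE -repc; case: eqP => // ->.
rewrite ffunE /= reph /heads_after /dir; case: eqP => [->|_].
  by rewrite (negbTE lso) (negbTE rso).
by case: (t \in ls); case: (t \in rs) => /=; rewrite ?subn1 ?addn1.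
Qed.

Lemma moves_walk k h o (p : pred (reading tapes)) ls rs N :
  out \notin ls -> out \notin rs ->
  (forall i s, i < N -> rep k (heads_after ls rs i h) o s -> p (read s)) ->
  (forall s, rep k (heads_after ls rs N h) o s -> ~~ p (read s)) ->
  moves k h o (walk p ls rs) (heads_after ls rs N h) o (N * 2 + 1).
Proof.
move=> lso rso pI pN.
apply: (@triple_weaken _ (rep k (heads_after ls rs 0 h) o) _
  (rep k (heads_after ls rs N h) o) _ _ (N * 2 + 1)) => // [s|].
  apply: rep_eq_heads => t; rewrite /heads_after.
  by case: dir; rewrite ?subn0 ?addn0.
apply: (triple_while (I := fun i => rep k (heads_after ls rs i h) o) (k := 1))
  => // [i|i iN]; first exact: rep_extensional.
rewrite /=; apply: (moves_eq_heads _ _ (moves_go lso rso)) => // t.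
rewrite /heads_after.
by case: dir; lia.
Qed.

(** Walking [t] to the left end transfers its position to the tapes of [rs];
    with [t] as the record of an earlier walk, this undoes that walk. *)
Lemma moves_drain k h o t ls rs : out \notin t :: ls -> out \notin rs ->
  moves k h o (walk (nonstart t) (t :: ls) rs)
    (heads_after (t :: ls) rs (h t) h) o (h t * 2 + 1).
Proof.
move=> lso rso; have tout : t != out.
  by apply: contraNneq lso => ->; rewrite mem_head.
have aft i : heads_after (t :: ls) rs i h t = h t - i.
  by rewrite /heads_after /dir mem_head.
apply: moves_walk => // [i s iN reps|s reps].
- by rewrite (nonstart_rep tout reps) aft subn_gt0.
- by rewrite (nonstart_rep tout reps) aft subnn.
Qed.

Lemma moves_rewind k h o t : t != out ->
  moves k h o (rewind t) (upd h t 0) o (h t * 2 + 1).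
Proof.
move=> tout; have lso : out \notin [:: t] by rewrite inE eq_sym.
apply: (moves_eq_heads _ _ (moves_drain lso _)) => // u.
by rewrite /heads_after /dir /upd inE; case: eqP => // ->; rewrite subnn.
Qed.

(** The specification of all program pieces between setup and halting: the word
    [l] is appended and the heads are back where they were, so that pieces
    compose without any knowledge of each other. *)
Definition emits F h l (c : {poly nat}) : Prop :=
  forall o, moves n h o F h (o ++ l) c.[n]%R.

Lemma emits_eq_heads F h h' l c : h =1 h' -> emits F h l c -> emits F h' l c.
Proof.
by move=> eqh eF o; apply: (moves_eq_heads _ eqh (eF o)) => t.
Qed.

Lemma emits_emit b h : emits (emit b) h [:: b] 1%R.
Proof.
move=> o; rewrite -polyC1 hornerC; apply: triple_prim => s [repc reph].
split=> [t i|t] /=; rewrite !ffunE /= reph.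
  rewrite !repc /tape_word; case: (t =P out) => [->|_] /=; last first.
    by case: eqP => // ->.
  case: i => [|i] //=; rewrite eqSS map_cat nth_cat size_map.
  case: eqP => [->|ne]; first by rewrite ltnn subnn.
  case: ltnP => // le; rewrite nth_default ?size_map //.
  by rewrite nth_default //=; lia.
by case: eqP => //= _; rewrite size_cat /= addn1.
Qed.

Lemma emits_skip h : emits skip h [::] 1%R.
Proof.
move=> o; rewrite -polyC1 hornerC cats0.
exact: (moves_eq_heads _ _ (moves_go _ _)).
Qed.

Lemma emits_seq F1 F2 h l1 l2 c1 c2 :
  emits F1 h l1 c1 -> emits F2 h l2 c2 ->
  emits (seq_frag F1 F2) h (l1 ++ l2) (c1 + c2)%R.
Proof.
by move=> e1 e2 o; rewrite hornerD catA; apply: triple_seq (e1 o) (e2 _).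
Qed.

Lemma emits_for_each t F h (l : nat -> seq bool) c :
  t != inp -> t != out -> h t = 0 ->
  (forall i, i < n -> emits F (upd h t i.+1) (l i) c) ->
  emits (for_each t F) h (flatten [seq l i | i <- iota 0 n])
    (for_each_cost c).
Proof.
move=> tinp tout ht0 eF o.
pose I i := rep n (upd h t i.+1) (o ++ flatten [seq l j | j <- iota 0 i]).
have upd_t v : upd h t v t = v by rewrite /upd eqxx.
have stepH v : heads_after [::] [:: t] 1 (upd h t v) =1 upd h t v.+1.
  move=> u; rewrite /heads_after /dir /upd !inE.
  by case: eqP => //; rewrite addn1.
apply: (@triple_weaken _ (rep n h o) _ (rep n (upd h t 0)
   (o ++ flatten [seq l j | j <- iota 0 n])) _ _
   (1 + ((n * (c.[n]%R + 1).+1 + 1) + (n.+1 * 2 + 1)))) => // [s||].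
- apply: rep_eq_heads => u; rewrite /upd; by case: eqP => // ->.
- rewrite /for_each_cost !(hornerD, hornerM, hornerX, hornerC).
  rewrite !(natrDE, natrME).
  have cost (m x : nat) :
    1 + (m * (x + 1).+1 + 1 + (m.+1 * 2 + 1)) <= m * (x + 4) + 5 by nia.
  exact: cost.
apply: (@triple_seq _ _ (I 0)).
  rewrite /I cats0; apply: (moves_eq_heads _ (stepH 0) (moves_go _ _)) => //.
    by move=> u; rewrite /upd; case: eqP => // ->.
  by rewrite inE eq_sym.
apply: (@triple_seq _ _ (I n)).
  apply: (triple_while (I := I)) => [i|i s iN Is|s Is|i iN].
  - exact: rep_extensional.
  - by rewrite (one_counter tinp tout Is) upd_t.
  - by rewrite (one_counter tinp tout Is) upd_t ltnn.
  rewrite /I -addn1 iotaD map_cat flatten_cat /= cats0 add0n catA addn1.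
  apply: (triple_seq (eF i iN _)).
  apply: (moves_eq_heads _ (stepH _) (moves_go _ _)) => //.
  by rewrite inE eq_sym.
rewrite -[X in X * 2](upd_t n.+1).
apply: (moves_eq_heads _ _ (moves_rewind tout)) => // u.
by rewrite /upd; case: eqP.
Qed.

Lemma emits_if_le x y F1 F2 h l1 l2 c1 c2 :
  x \notin [:: out; scratch] -> y \notin [:: out; scratch] ->
  h scratch = 0 -> h x <= n -> h y <= n ->
  emits F1 h l1 c1 -> emits F2 h l2 c2 ->
  emits (if_le x y F1 F2) h (if h x <= h y then l1 else l2)
    (if_le_cost c1 c2).
Proof.
rewrite !inE !negb_or => /andP[xo xs] /andP[yo ys] hs hx hy e1 e2 o.
set N := minn (h x) (h y).
pose h1 := heads_after [:: x; y] [:: scratch] N h.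
have ax i : heads_after [:: x; y] [:: scratch] i h x = h x - i.
  by rewrite /heads_after /dir !inE eqxx.
have ay i : heads_after [:: x; y] [:: scratch] i h y = h y - i.
  by rewrite /heads_after /dir !inE eqxx orbT.
have h1s : h1 scratch = N.
  rewrite /h1 /heads_after /dir !inE ![scratch == _]eq_sym.
  by rewrite (negbTE xs) (negbTE ys) /= hs.
have xyo : out \notin [:: x; y].
  by rewrite !inE ![out == _]eq_sym negb_or xo yo.
have back : moves n h1 o (walk (nonstart scratch) [:: scratch] [:: x; y])
    h o (N * 2 + 1).
  rewrite -h1s.
  apply: (moves_eq_heads _ _ (moves_drain (ls := [::]) _ xyo)) => // u.
  rewrite h1s /h1 /heads_after /dir !inE.
  case: (u =P scratch) => [->|_].
    by rewrite ![scratch == _]eq_sym (negbTE xs) (negbTE ys) /= hs; lia.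
  case: (u =P x) => [->|_] /=; first by rewrite /N; lia.
  by case: (u =P y) => [->|_] //=; rewrite /N; lia.
apply: (@triple_weaken _ (rep n h o) _
   (rep n h (o ++ if h x <= h y then l1 else l2)) _ _
   ((N * 2 + 1) + ((N * 2 + 1) + (c1.[n]%R + c2.[n]%R)).+1)) => //.
  rewrite /if_le_cost !(hornerD, hornerM, hornerX, hornerC) !(natrDE, natrME).
  have cost (m u v i : nat) : i <= m ->
    i * 2 + 1 + (i * 2 + 1 + (u + v)).+1 <= u + v + (4 * m + 3) by lia.
  by apply: cost; rewrite /N; lia.
apply: (@triple_seq _ _ (rep n h1 o)).
  apply: moves_walk => [||i s iN reps|s reps].
  - exact: xyo.
  - by rewrite inE.
  - by rewrite !(nonstart_rep _ reps) // ax ay; rewrite /N in iN; lia.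
  - by rewrite !(nonstart_rep _ reps) // ax ay /N; lia.
apply: triple_ite; first exact: rep_extensional.
  case: leqP => [le_xy|lt_yx] s [reps].
    by rewrite (nonstart_rep _ reps) // /h1 ax /N; lia.
  move=> _; move: s reps; apply: (triple_seq back).
  by apply: triple_weaken (e2 o) => //; lia.
case: leqP => [le_xy|lt_yx] s [reps]; last first.
  by rewrite (nonstart_rep _ reps) // /h1 ax /N; lia.
move=> _; move: s reps; apply: (triple_seq back).
by apply: triple_weaken (e1 o) => //; lia.
Qed.

(** Entry (a, b) of the coded matrix, where [n.+1] symbols precede the
    matrix. *)
Definition adj_bit (a b : nat) : bool := nth false w (n.+1 + a * n + b).

Lemma emits_if_adj x y a b F1 F2 h l1 l2 c1 c2 :
  x \notin [:: inp; out; scan; scratch] ->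
  y \notin [:: inp; out; scan; scratch] ->
  h inp = 0 -> h scan = 0 -> h scratch = 0 -> h x = a.+1 -> h y = b.+1 ->
  a < n -> b < n -> emits F1 h l1 c1 -> emits F2 h l2 c2 ->
  emits (if_adj x y F1 F2) h (if adj_bit a b then l1 else l2)
    (if_adj_cost c1 c2).
Proof.
move=> x_ok y_ok hi hn hs hx hy an bn e1 e2 o.
move: x_ok y_ok; rewrite !inE !negb_or.
move=> /and4P[xi xo xn xs] /and4P[yi yo yn ys].
have E := (negbTE xi, negbTE xo, negbTE xn, negbTE xs, negbTE yi, negbTE yo,
  negbTE yn, negbTE ys).
have E' : ((inp == x = false) * (out == x = false) * (scan == x = false) *
  (scratch == x = false) * (inp == y = false) * (out == y = false) *
  (scan == y = false) * (scratch == y = false))%type.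
  by rewrite ![_ == x]eq_sym ![_ == y]eq_sym !E.
(* [hA i] holds after i rounds of the loop on [x], [hB] once [x] is restored,
   [hC] when the input head has arrived and [hD] once [y] is restored. *)
pose pos := 1 + a.+1 * n + b.+1.
pose hA i := upd (upd (upd h inp (1 + i * n)) x (a.+1 - i)) scratch i.
pose hB := upd h inp (1 + a.+1 * n).
pose hC := upd (upd (upd h inp pos) y 0) scratch b.+1.
pose hD := upd h inp pos.
apply: (@triple_weaken _ (rep n h o) _
   (rep n h (o ++ if adj_bit a b then l1 else l2)) _ _
   (1 + ((a.+1 * (1 + ((n * 2 + 1) + (n.+1 * 2 + 1))).+1 + 1) +
     ((a.+1 * 2 + 1) + ((b.+1 * 2 + 1) + ((b.+1 * 2 + 1) +
     ((pos * 2 + 1) + (c1.[n]%R + c2.[n]%R)).+1)))))) => //.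
  rewrite /if_adj_cost !(hornerD, hornerM, hornerX, hornerC) !(natrDE, natrME).
  rewrite /pos.
  have cost (m u v i j : nat) : i < m -> j < m ->
    1 + (i.+1 * (1 + (m * 2 + 1 + (m.+1 * 2 + 1))).+1 + 1 +
      (i.+1 * 2 + 1 + (j.+1 * 2 + 1 + (j.+1 * 2 + 1 +
      ((1 + i.+1 * m + j.+1) * 2 + 1 + (u + v)).+1)))) <=
    u + v + (6 * m * m + 14 * m + 9) by nia.
  exact: cost.
apply: (@triple_seq _ _ (rep n (hA 0) o)).
  apply: (moves_eq_heads _ _ (moves_go _ _)) => // u.
  rewrite /heads_after /dir /hA /upd !inE.
  case: (u =P scratch) => [->|_] //=.
  case: (u =P x) => [->|_]; first by rewrite E hx subn0.
  by case: (u =P inp) => [->|_] //=; rewrite hi.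
apply: (@triple_seq _ _ (rep n (hA a.+1) o)).
  apply: (triple_while (I := fun i => rep n (hA i) o))
    => [i|i s iN reps|s reps|i iN].
  - exact: rep_extensional.
  - by rewrite (nonstart_rep xo reps) /hA /upd E eqxx subn_gt0.
  - by rewrite (nonstart_rep xo reps) /hA /upd E eqxx subnn.
  pose h1 := heads_after [:: x] [:: scratch; scan] 1 (hA i).
  pose h2 := heads_after [::] [:: scan; inp] n h1.
  have h1n : h1 scan = 1.
    by rewrite /h1 /heads_after /dir /hA /upd !inE /= E' /= hn.
  have h2n : h2 scan = n.+1 by rewrite /h2 /heads_after /= h1n add1n.
  apply: (@triple_seq _ _ (rep n h1 o)).
    by apply: moves_go; rewrite !inE ?E'.
  apply: (@triple_seq _ _ (rep n h2 o)).
    have aft j : heads_after [::] [:: scan; inp] j h1 scan = j.+1.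
      by rewrite /heads_after /= h1n add1n.
    apply: moves_walk => // [j s jn reps|s reps].
      by rewrite (one_counter _ _ reps) // aft /=.
    by rewrite (one_counter _ _ reps) // aft /= ltnn.
  rewrite -[in X in X * 2]h2n.
  apply: (moves_eq_heads _ _ (moves_rewind _)) => // u.
  rewrite /h2 /h1 /heads_after /dir /hA /upd !inE.
  case: (u =P scan) => [->|_] /=; first by rewrite E' hn.
  case: (u =P x) => [->|_] /=; first by rewrite E /= E /=; lia.
  case: (u =P scratch) => [->|_] /=; first by rewrite addn1.
  by case: (u =P inp) => _ /=; lia.
apply: (@triple_seq _ _ (rep n hB o)).
  have hAs : hA a.+1 scratch = a.+1 by rewrite /hA /upd eqxx.
  rewrite -[in X in X * 2]hAs.
  apply: (moves_eq_heads _ _ (moves_drain (ls := [::]) _ _)) => // [u|];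
    last by rewrite inE E'.
  rewrite hAs /hB /hA /heads_after /dir /upd !inE.
  case: (u =P scratch) => [->|_] /=; first by rewrite hs subnn.
  by case: (u =P x) => [->|_] //=; rewrite E hx subnn.
apply: (@triple_seq _ _ (rep n hC o)).
  have hBy : hB y = b.+1 by rewrite /hB /upd E.
  rewrite -[in X in X * 2]hBy.
  apply: (moves_eq_heads _ _ (moves_drain (ls := [::]) _ _)) => // [u|];
    last by rewrite inE E'.
  rewrite hBy /hC /hB /heads_after /dir /upd !inE.
  case: (u =P y) => [->|_] /=; first by rewrite !E hy subnn.
  case: (u =P scratch) => [->|_] /=; first by rewrite hs.
  by case: (u =P inp).
apply: (@triple_seq _ _ (rep n hD o)).
  have hCs : hC scratch = b.+1 by rewrite /hC /upd eqxx.
  rewrite -[in X in X * 2]hCs.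
  apply: (moves_eq_heads _ _ (moves_drain (ls := [::]) _ _)) => // [u|];
    last by rewrite inE E'.
  rewrite hCs /hC /hD /heads_after /dir /upd !inE.
  case: (u =P scratch) => [->|_] /=; first by rewrite hs subnn.
  by case: (u =P y) => [->|_] //=; rewrite E hy.
have back : moves n hD o (rewind inp) h o (pos * 2 + 1).
  have hDi : hD inp = pos by rewrite /hD /upd eqxx.
  rewrite -hDi; apply: (moves_eq_heads _ _ (moves_rewind _)) => // u.
  by rewrite /hD /upd; case: (u =P inp) => // ->.
have bitE s : rep n hD o s -> one inp (read s) = adj_bit a b.
  move=> reps; rewrite (one_rep _ reps) // /hD /upd eqxx /tape_word eqxx.
  by rewrite /pos /adj_bit addSn /=; congr nth; lia.
apply: triple_ite; first exact: rep_extensional.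
  case: ifP => adj s [reps]; rewrite bitE // adj // => _; move: s reps.
  apply: (triple_seq back); apply: triple_weaken (e1 o) => //; exact: leq_addr.
case: ifP => adj s [reps]; rewrite bitE // adj // => _; move: s reps.
apply: (triple_seq back); apply: triple_weaken (e2 o) => //; exact: leq_addl.
Qed.

Lemma emits_if_lt x y F1 F2 h l1 l2 c1 c2 :
  x \notin [:: out; scratch] -> y \notin [:: out; scratch] ->
  h scratch = 0 -> h x <= n -> h y <= n ->
  emits F1 h l1 c1 -> emits F2 h l2 c2 ->
  emits (if_lt x y F1 F2) h (if h x < h y then l1 else l2) (if_le_cost c2 c1).
Proof.
move=> x_ok y_ok hs hx hy e1 e2.
by rewrite ltnNge (if_neg (h y <= h x)); apply: emits_if_le.
Qed.

Lemma emits_if_eq x y F1 F2 h l1 l2 c1 c2 :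
  x \notin [:: out; scratch] -> y \notin [:: out; scratch] ->
  h scratch = 0 -> h x <= n -> h y <= n ->
  emits F1 h l1 c1 -> emits F2 h l2 c2 ->
  emits (if_eq x y F1 F2) h (if h x == h y then l1 else l2) (if_eq_cost c1 c2).
Proof.
move=> x_ok y_ok hs hx hy e1 e2.
have -> : (if h x == h y then l1 else l2) =
    (if h x <= h y then if h y <= h x then l1 else l2 else l2).
  by case: ltngtP.
by apply: emits_if_le => //; apply: emits_if_le.
Qed.

(** [Fe] must emit the same word for all members of a block.  The first of the
    n + 1 runs happens before the loop on [c] starts, with its head still on
    cell 0, which is why [i] ranges over 0, ..., n. *)
Lemma emits_vertices a b c Fv Fe h (g : vertex_name -> seq bool) cv ce :
  uniq [:: inp; out; scan; scratch; a; b; c] ->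
  h inp = 0 -> h scan = 0 -> h scratch = 0 -> h a = 0 -> h b = 0 -> h c = 0 ->
  (forall v, v < n -> emits Fv (upd h a v.+1) (g (inl v)) cv) ->
  (forall u v i, u < n -> v < n -> i <= n ->
     emits Fe (upd (upd (upd h a u.+1) b v.+1) c i) (g (inr (u, v))) ce) ->
  emits (vertices a b c Fv Fe) h
    (flatten [seq g x | x <- vertex_names n adj_bit]) (vertices_cost cv ce).
Proof.
move=> uniq_t hi hn hs ha hb hc eFv eFe.
have [ai ao an as_] : [/\ a != inp, a != out, a != scan & a != scratch].
  by split; apply: contraTneq uniq_t => ->; rewrite /= ?inE ?eqxx ?orbT ?andbF.
have [bi bo bn bs] : [/\ b != inp, b != out, b != scan & b != scratch].
  by split; apply: contraTneq uniq_t => ->; rewrite /= ?inE ?eqxx ?orbT ?andbF.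
have [ci co cn cs] : [/\ c != inp, c != out, c != scan & c != scratch].
  by split; apply: contraTneq uniq_t => ->; rewrite /= ?inE ?eqxx ?orbT ?andbF.
have [ab ac bc] : [/\ a != b, a != c & b != c].
  by split; apply: contraTneq uniq_t => ->; rewrite /= ?inE ?eqxx ?orbT ?andbF.
have upd_ne t u v (k : tapes -> nat) : t != u -> upd k t v u = k u.
  by rewrite /upd eq_sym => /negbTE ->.
have upd_eq t v (k : tapes -> nat) : upd k t v t = v by rewrite /upd eqxx.
rewrite /vertex_names map_cat flatten_cat; apply: emits_seq.
  by rewrite -map_comp; apply: emits_for_each.
rewrite flatten_allpairs flatten_filter flatten_allpairs.
apply: emits_for_each => // u un; apply: emits_for_each => [|||v vn] //.
  by rewrite upd_ne.
set k := upd _ b v.+1.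
have ka : k a = u.+1 by rewrite /k upd_ne 1?eq_sym // upd_eq.
have kb : k b = v.+1 by rewrite /k upd_eq.
have k0 t : a != t -> b != t -> k t = h t by move=> ? ?; rewrite /k !upd_ne.
set l := flatten _.
have -> : (if (u < v) && adj_bit u v then l else [::]) =
    (if k a < k b then if adj_bit u v then l else [::] else [::]).
  by rewrite ka kb ltnS; case: (u < v).
apply: emits_if_lt.
- by rewrite !inE negb_or ao.
- by rewrite !inE negb_or bo.
- by rewrite k0.
- by rewrite ka.
- by rewrite kb.
- apply: emits_if_adj => //.
  + by rewrite !inE !negb_or ai ao an.
  + by rewrite !inE !negb_or bi bo bn.
  + by rewrite k0.
  + by rewrite k0.
  + by rewrite k0.
  + rewrite /l /=; apply: emits_seq.
      apply: emits_eq_heads (eFe u v 0 un vn (leq0n n)) => t.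
      by rewrite {1}/upd; case: eqP => // ->; rewrite k0.
    rewrite (iotaDl 1 0) -map_comp; apply: emits_for_each => // [|i iN].
      by rewrite k0.
    exact: eFe.
  + exact: emits_skip.
- exact: emits_skip.
Qed.

(** The number of leading ones is the index of the first 0, or the length of
    the word if there is none; in either case the input head then reads a symbol
    other than 1. *)
Lemma setup_triple :
  triple (eq (init_store inp w)) setup (rep n (fun=> 0) [::])
    (4%N%:P * 'X + 5%N%:P : {poly nat}).[n]%R.
Proof.
rewrite !(hornerD, hornerM, hornerX, hornerC) !(natrDE, natrME).
have -> : 4 * n + 5 = 1 + ((n * 2 + 1) + (n.+1 * 2 + 1)) by lia.
apply: (@triple_seq _ _ (rep 0 (fun=> 1) [::])).
  apply: triple_prim => s <-; split=> [t i|t] /=; rewrite ?ffunE /=.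
    rewrite ?ffunE /= /tape_word; case: eqP => [->|_].
      by case: (t == inp).
    by case: (t == inp); case: (t == out).
  by case: (t == out).
pose I i := rep i (fun=> i.+1) [::].
apply: (@triple_seq _ _ (I n)).
  apply: (triple_while (I := I)) => [i|i s iN reps|s reps|i iN].
  - exact: rep_extensional.
  - rewrite (one_rep _ reps) //= /tape_word eqxx.
    by have /negbT := before_find false iN; rewrite /= eqbF_neg negbK.
  - rewrite (one_rep _ reps) //= /tape_word eqxx -/n.
    have [w_false|w_true] := boolP (false \in w); first by rewrite nth_index.
    by rewrite nth_default // /n (memNindex w_true).
  apply: triple_prim => s [repc reph]; split=> [t j|t] /=; rewrite !ffunE reph.
    rewrite !repc /tape_word; case: (t =P out) => [->|_] /=.
      by case: eqP => // ->.
    case: (t =P inp) => _; first by case: eqP => // ->.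
    have onesE k l : word_cells (nseq k true) l.+1 =
        if l < k then Bit true else Blank.
      by rewrite /word_cells map_nseq nth_nseq.
    case: j => // j.
    by rewrite eqSS -[true :: _]/(nseq i.+1 true) !onesE ltnS; case: ltngtP.
  by case: (t == out).
have all_but t : (t \in inp :: rem out (enum tapes)) = (t != out).
  rewrite inE mem_rem_uniq ?enum_uniq // inE mem_enum andbT.
  by case: (t =P inp) => // ->.
have not_out : out \notin inp :: rem out (enum tapes) by rewrite all_but eqxx.
have run := moves_drain (k := n) (h := fun=> n.+1) (o := [::]) not_out
  (isT : out \notin [::]).
apply: triple_weaken run => // s [repc reph]; split=> // t.
rewrite reph /heads_after /dir all_but.
by case: (t =P out) => //= _; rewrite subnn.
Qed.

Definition reduction_output : seq bool :=
  let names := vertex_names n adj_bit in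
  nseq (size names) true ++ false :: nseq (size names) true ++ false ::
    [seq name_adj x y | x <- names, y <- names].

Lemma emits_header :
  emits header (fun=> 0)
    (nseq (size (vertex_names n adj_bit)) true ++ [:: false]) header_cost.
Proof.
apply: emits_seq; last exact: emits_emit.
have -> : nseq (size (vertex_names n adj_bit)) true =
    flatten [seq [:: true] | x <- vertex_names n adj_bit].
  by elim: (vertex_names _ _) => //= x s ->.
by apply: emits_vertices => // *; apply: emits_emit.
Qed.

Lemma emits_test_eq x y h :
  x \notin [:: out; scratch] -> y \notin [:: out; scratch] ->
  h scratch = 0 -> h x <= n -> h y <= n ->
  emits (test_eq x y) h [:: h x == h y] (if_eq_cost 1 1).
Proof.
move=> x_ok y_ok hs hx hy.
have -> : [:: h x == h y] = if h x == h y then [:: true] else [:: false].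
  by case: eqP.
by apply: emits_if_eq => //; apply: emits_emit.
Qed.

Lemma emits_body :
  emits body (fun=> 0)
    [seq name_adj x y | x <- vertex_names n adj_bit,
                        y <- vertex_names n adj_bit]
    body_cost.
Proof.
apply: (emits_vertices (g := fun x => [seq name_adj x y | y <- _])) => //.
  move=> v vn; rewrite -flatten_map1.
  apply: emits_vertices => // [v' v'n|a b i an bn _] /=.
    exact: emits_test_eq.
  have -> : [:: (v == a) || (v == b)] =
      if v == a then [:: true] else [:: v == b].
    by case: eqP.
  by apply: emits_if_eq => //; [exact: emits_emit | exact: emits_test_eq].
move=> u v i un vn _; rewrite -flatten_map1.
apply: emits_vertices => // [v' v'n|a b j an bn _] /=.
  exact: emits_emit.
have -> : [:: (u, v) == (a, b)] = if u == a then [:: v == b] else [:: false].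
  by rewrite xpair_eqE; case: eqP.
by apply: emits_if_eq => //; [exact: emits_test_eq | exact: emits_emit].
Qed.

Lemma program_triple :
  triple (eq (init_store inp w)) program
    (fun s => s.1 out =1 word_cells reduction_output) program_cost.[n]%R.
Proof.
apply: (@triple_weaken _ (eq (init_store inp w)) _
  (rep n (fun=> 0) reduction_output) _ _ program_cost.[n]%R) => //.
  by move=> s [repc _] i; rewrite repc.
rewrite hornerD; apply: triple_seq setup_triple _.
have := emits_seq emits_header (emits_seq emits_header emits_body).
rewrite -!catA /= => /(_ [::]); exact.
Qed.

End Programs.

Lemma horner_nat_le (p : {poly nat}) (m k : nat) : m <= k -> p.[m]%R <= p.[k]%R.
Proof.
move=> mk; rewrite !horner_coef; apply: leq_sum => i _.
by rewrite leq_mul // !natrXE; case: (val i) => // j; rewrite leq_exp2r.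
Qed.

(** Costs are polynomials in the number of leading ones, which the length of
    the word bounds. *)
Lemma polytime_reduction : polytime reduction_output.
Proof.
exists (machine_of program inp out), program_cost => w.
apply: machine_ofP (erefl (init_store inp w)).
apply: triple_weaken (@program_triple w) => //.
exact/horner_nat_le/index_size.
Qed.

(** * The vertices of H_G in the order of the machine *)

Section Enumeration.
Variables (n : nat) (G : sgraph 'I_n).

(** The end points in increasing order; the default (0, 0) is never taken on
    edges. *)
Definition edge_name (e : {set 'I_n}) : nat * nat :=
  if [pick p : 'I_n * 'I_n | (p.1 < p.2) && (e == [set p.1; p.2])] is Some p
  then (val p.1, val p.2) else (0, 0).

Definition side_name (x : HG_side G) : vertex_name :=
  match x with inl v => inl (val v) | inr (e, _) => inr (edge_name (val e)) end.

Definition ordered_edges : seq ('I_n * 'I_n) :=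
  [seq p : 'I_n * 'I_n <- [seq (a, b) | a <- enum 'I_n, b <- enum 'I_n] |
     (p.1 < p.2) && adjacent G p.1 p.2].

Definition edge_list : seq (edge_type G) :=
  pmap insub [seq [set p.1; p.2] | p : 'I_n * 'I_n <- ordered_edges].

(** The enumeration of a side of H_G that parallels the traversal by the
    machine. *)
Definition side_list : seq (HG_side G) :=
  [seq inl v | v <- enum 'I_n] ++
  [seq inr (e, i) | e <- edge_list, i <- enum 'I_#|'I_n|.+1].

Lemma set2_ltn_inj (a b c d : 'I_n) :
  a < b -> c < d -> [set a; b] = [set c; d] -> (a, b) = (c, d).
Proof.
move=> ab cd /setP eq_ab.
have /[!inE] := eq_ab a; have /[!inE] := eq_ab b.
rewrite !eqxx orbT /= => /esym/orP[]/eqP eb /esym/orP[]/eqP ea;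
  by subst=> //; lia.
Qed.

Lemma edge_nameE (a b : 'I_n) :
  a < b -> edge_name [set a; b] = (val a, val b).
Proof.
move=> ab; rewrite /edge_name.
case: pickP => [[c d] /= /andP[cd /eqP eq_ab]|/(_ (a, b))].
  by have [-> ->] := set2_ltn_inj ab cd eq_ab.
by rewrite /= ab eqxx.
Qed.

Lemma edge_orderedP (e : edge_type G) :
  exists a b : 'I_n, [/\ a < b, adjacent G a b & val e = [set a; b]].
Proof.
have /cards2P[a [b [neq_ab def_e]]] : #|val e| == 2.
  by rewrite (edge_card2 (valP e)).
wlog ab : a b neq_ab def_e / a < b.
  move=> IH; case: (ltngtP a b) => [ab|ba|/val_inj eq_ab].
  - exact: IH def_e ab.
  - by apply: IH ba; rewrite 1?eq_sym // setUC.
  - by rewrite eq_ab eqxx in neq_ab.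
by exists a, b; split; rewrite // /adjacent -def_e (valP e).
Qed.

(** Adjacency in H_G depends on the names only, which is what allows the machine
    to decide it. *)
Lemma HG_adj_name (x y : HG_side G) :
  HG_adj x y = name_adj (side_name x) (side_name y).
Proof.
case: x y => [v|[e i]] [v'|[f j]] //=.
  have [a [b [ab _ ->]]] := edge_orderedP f.
  by rewrite edge_nameE // !inE.
have [a [b [ab _ def_e]]] := edge_orderedP e.
have [c [d [cd _ def_f]]] := edge_orderedP f.
rewrite -val_eqE !def_e !def_f !edge_nameE //.
apply/eqP/eqP => [|[/val_inj-> /val_inj->] //].
by move/(set2_ltn_inj ab cd) => [-> ->].
Qed.

Lemma val_edge_list : [seq val e | e <- edge_list] =
  [seq [set p.1; p.2] | p : 'I_n * 'I_n <- ordered_edges].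
Proof.
rewrite (pmap_filter (insubK _)); apply/all_filterP/allP=> e /mapP[p].
by rewrite mem_filter => /andP[/andP[_ adj_p] _] ->; rewrite insubT.
Qed.

Lemma map_edge_name : [seq edge_name (val e) | e <- edge_list] =
  [seq (val p.1, val p.2) | p : 'I_n * 'I_n <- ordered_edges].
Proof.
rewrite (map_comp edge_name val) val_edge_list -map_comp; apply/eq_in_map=> p.
by rewrite mem_filter => /andP[/andP[lt_p _] _]; exact: edge_nameE.
Qed.

Lemma uniq_side_list : uniq side_list.
Proof.
rewrite cat_uniq map_inj_uniq ?enum_uniq; last by move=> ? ? [].
have uniq_edges : uniq edge_list.
  rewrite -(map_inj_uniq val_inj) val_edge_list map_inj_in_uniq.
    rewrite filter_uniq // allpairs_uniq ?enum_uniq //.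
    by move=> [? ?] [? ?].
  move=> [a b] [c d]; rewrite !mem_filter /=.
  by move=> /andP[/andP[ab _] _] /andP[/andP[cd _] _]; exact: set2_ltn_inj.
rewrite allpairs_uniq ?enum_uniq // ?andbT;
  last by move=> [? ?] [? ?] _ _ [-> ->].
by apply/hasPn=> _ /allpairsP[p [_ _ ->]]; apply/mapP=> -[].
Qed.

Lemma mem_side_list (x : HG_side G) : x \in side_list.
Proof.
case: x => [v|[e i]]; rewrite mem_cat; apply/orP; [left|right].
  by rewrite map_f // mem_enum.
apply/allpairsP; exists (e, i); split; rewrite ?mem_enum //=.
have [a [b [ab adj_ab def_e]]] := edge_orderedP e.
rewrite -(mem_map val_inj) val_edge_list def_e.
apply/mapP; exists (a, b) => //; rewrite mem_filter /= ab adj_ab.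
by apply/allpairsP; exists (a, b); rewrite !mem_enum.
Qed.

Lemma nth_allpairs (S S' R : Type) (f : S -> S' -> R) x0 y0 z0 s s' i j :
  i < size s -> j < size s' ->
  nth z0 [seq f x y | x <- s, y <- s'] (i * size s' + j) =
    f (nth x0 s i) (nth y0 s' j).
Proof.
elim: s i => //= x s IHs [|i] lt_i lt_j; rewrite nth_cat size_map.
  by rewrite mul0n lt_j (nth_map y0).
rewrite mulSn -addnA ltnNge leq_addr /= addKn; exact: IHs.
Qed.

Lemma index_code : index false (sgraph_code G) = n.
Proof.
rewrite /sgraph_code index_cat size_nseq mem_nseq /= andbF; exact: addn0.
Qed.

Lemma adj_bit_code (a b : 'I_n) : adj_bit (sgraph_code G) a b = adjacent G a b.
Proof.
rewrite /adj_bit index_code /sgraph_code nth_cat size_nseq -addnA ltnNge.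
rewrite addSn ltnW ?leq_addr //= ?ltnS ?leq_addr //.
have := @nth_allpairs _ _ _ (adjacent G) a b false (enum 'I_n) (enum 'I_n) a b.
rewrite size_enum_ord !nth_ord_enum => <- //.
by rewrite subSn ?leq_addr //= addKn.
Qed.

Lemma map_side_name : [seq side_name x | x <- side_list] =
  vertex_names n (adj_bit (sgraph_code G)).
Proof.
rewrite /vertex_names map_cat; congr (_ ++ _).
  by rewrite -val_enum_ord -!map_comp.
rewrite map_allpairs.
have -> : edge_names n (adj_bit (sgraph_code G)) =
    [seq edge_name (val e) | e <- edge_list].
  rewrite map_edge_name /edge_names -val_enum_ord.
  rewrite allpairs_mapl allpairs_mapr /ordered_edges.
  rewrite -(map_allpairs (fun p => (val p.1, val p.2))
    (fun a b : 'I_n => (a, b))).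
  rewrite filter_map; congr map; apply: eq_filter => -[a b] /=.
  by rewrite adj_bit_code.
have map_cst (S R : Type) (z : R) (s : seq S) :
    [seq z | _ <- s] = nseq (size s) z.
  by elim: s => //= _ s ->.
rewrite -map_comp; congr flatten; apply: eq_map => e.
by rewrite map_cst [RHS]map_cst size_enum_ord size_iota card_ord.
Qed.

Definition side_tuple : (size side_list).-tuple (HG_side G) :=
  in_tuple side_list.

Lemma side_tuple_bij : bijective (tnth side_tuple).
Proof.
have lt_index x : index x side_list < size side_list.
  by rewrite index_mem mem_side_list.
exists (fun x => Ordinal (lt_index x)) => [i|x].
  apply: val_inj => /=.
  by rewrite (tnth_nth (tnth side_tuple i)) /= index_uniq ?uniq_side_list.
by rewrite (tnth_nth x) /= nth_index ?mem_side_list.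
Qed.

(** H_G with its vertices numbered in the order in which they are listed. *)
Definition HG_ord : bigraph 'I_(size side_list) 'I_(size side_list) :=
  [set p | HG_adj (tnth side_tuple p.1) (tnth side_tuple p.2)].

Lemma reduction_outputE :
  reduction_output (sgraph_code G) = bigraph_code HG_ord.
Proof.
rewrite /reduction_output /bigraph_code index_code -map_side_name size_map.
suff -> : [seq name_adj x y | x <- map side_name side_list,
                              y <- map side_name side_list] =
    matrix_code (fun u v => (u, v) \in HG_ord) by [].
have defL : side_list = [seq tnth side_tuple i | i <- enum 'I_(size side_list)].
  by rewrite map_tnth_enum.
rewrite /matrix_code allpairs_mapl allpairs_mapr [in LHS]defL.
rewrite allpairs_mapl allpairs_mapr.
by apply: eq_allpairs => u v /=; rewrite inE HG_adj_name.
Qed.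

End Enumeration.

Lemma reduces_half_size_clique_edge :
  reduces_to half_size_clique_edge alpha_bal_bip.
Proof.
exists reduction_output => [|x]; first exact: polytime_reduction.
exists (AbbInstance (HG_ord (hsce_graph x))).
  exact: reduction_outputE.
case: x => n G /= _ qG; rewrite -[n in (n%:R)%R]card_ord.
rewrite (omega_half_cliqueP qG) (half_clique_balanced qG).
apply: iff_sym; apply: balanced_relabel (side_tuple_bij G) (side_tuple_bij G) _.
by move=> u v; rewrite !inE.
Qed.

Theorem theorem2p8 :
  (forall (V : finType) (G : sgraph V), quarter_edges G ->
     ((exists2 C : {set V}, clique G C & (#|C|%:R = #|V|%:R / 2 :> rat)%R)
        <-> (#|V|%:R / 2 <= (omega G)%:R :> rat)%R)
     /\ ((#|V|%:R / 2 <= (omega G)%:R :> rat)%R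
        <-> alpha (sgraph_of_bigraph (HG G)) = alpha_bal (HG G)))
  /\ reduces_to half_size_clique_edge alpha_bal_bip.
Proof.
split=> [V G qG|]; last exact: reduces_half_size_clique_edge.
split; rewrite (omega_half_cliqueP qG); last exact: half_clique_balanced.
have halfE (k : nat) : (k%:R = #|V|%:R / 2 :> rat)%R <-> 2 * k = #|V|.
  have two_neq0 : (2 != 0 :> rat)%R by [].
  split=> [/(congr1 ( *%R^~ 2%R))|<-]; last by rewrite natrM mulrC mulKf.
  by rewrite divfK // -natrM mulnC => /eqP; rewrite eqr_nat => /eqP.
by split=> -[C clC /halfE C2]; exists C.
Qed.
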